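(* Let $n \ge 4$ and let $f : [1,\infty) \to \mathbb{R}^+$ be a function such that $\log f$ is concave. Then for every unicyclic graph $G$ with $n$ vertices, $$ f(n-1)\, f(2)^2 f(1)^{n-3} \le II_f(G) \le f(2)^n, $$ and both inequalities are attained (i.e., for each such $n$ and $f$, each of the two bounds is equal to $II_f(G)$ for some unicyclic graph $G$ with $n$ vertices).
   Context: All graphs are finite, connected, simple (no loops, no multiple edges) and have at least one edge. A unicyclic graph is a graph containing exactly one cycle. For a vertex $u$ of $G$, $d_u$ denotes its degree. $\mathbb{R}^+$ denotes the positive real numbers. For a function $f:[1,\infty)\to\mathbb{R}^+$, $II_f(G) = \prod_{u\in V(G)} f(d_u)$. *)

(* Defs.v *)
From HB Require Import structures.
From mathcomp Require Import all_boot all_order all_algebra.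
From mathcomp Require Import all_classical all_reals all_analysis.

Set Implicit Arguments.
Unset Strict Implicit.
Unset Printing Implicit Defensive.

Import Order.TTheory GRing.Theory Num.Theory.
Local Open Scope ring_scope.

Record sgraph := SGraph {
  vertex :> finType;
  adj : rel vertex;
  adj_sym : symmetric adj;
  adj_irr : irreflexive adj;
  adj_connected : forall u v : vertex, connect adj u v;
  adj_has_edge : exists u v : vertex, adj u v }.

Definition degree (G : sgraph) (u : G) : nat := #|[set v | adj u v]|.

(* A cycle is identified with its set of edges, so that the rotations and the
   reversal of a cyclic sequence of vertices all give the same cycle.
   The bound on the size excludes [ucycle]s of size 2, which go back and forth
   along one edge, and the empty one. *)
Definition cycle_edges (G : sgraph) (s : seq G) : {set {set G}} :=
  [set [set x; next s x] | x in s].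

Definition is_cycle (G : sgraph) (C : {set {set G}}) : Prop :=
  exists s : seq G, [/\ ucycle (@adj G) s, (2 < size s)%N & C = cycle_edges s].

Definition unicyclic (G : sgraph) : Prop :=
  exists! C : {set {set G}}, is_cycle C.

Definition II (R : realType) (f : R -> R) (G : sgraph) : R :=
  \prod_(u : G) f (degree u)%:R.

Definition concave_function (R : realType) (D : set R) (g : R -> R) : Prop :=
  @convex_function R R^o D (fun x => - g x).

(* Main.v *)
(* Let every vertex of the cycle point to the next one, and every other vertex
   to a neighbour closer to the cycle.  An edge not of the form {v, p v} would
   close a second cycle, so a unicyclic graph has as many edges as vertices and
   its degrees sum to 2n; moreover at least three of them are >= 2.  With
   g = ln f concave, the upper bound follows by summing the tangent inequality
   g d <= g 2 + (g 3 - g 2) (d - 2), the lower one by summing chord bounds of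
   slope (g (n - 1) - g 2) / (n - 3).  The upper bound is attained by the cycle,
   the lower one by a triangle with n - 3 pendant vertices at one corner. *)
Require Import Defs.
From mathcomp Require Import all_boot all_order all_algebra.
From mathcomp Require Import all_classical all_reals all_analysis.
From mathcomp Require Import fintype finset ring lra zify.

Set Implicit Arguments.
Unset Strict Implicit.
Unset Printing Implicit Defensive.

Import Order.TTheory GRing.Theory Num.Theory.

(** * Cycles and the neighbours of their vertices *)

Section Cycles.
Variable G : sgraph.
Implicit Types (s : seq G) (x y v w : G).

Lemma next_next_neq s x :
  uniq s -> 2 < size s -> x \in s -> next s (next s x) != x.
Proof.
move=> us ss /rot_to[i t E].
rewrite -!(next_rot i us) E; rewrite -(size_rot i) E in ss.
rewrite -(rot_uniq i) E in us.
case: t us ss {E} => [|y [|z t]] //= us _.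
move: us; rewrite !inE !negb_or -!andbA => /and5P[xy xz _ yz _].
by rewrite eqxx (eq_sym y x) (negPf xy) eqxx eq_sym.
Qed.

Lemma next_neq_prev s x :
  uniq s -> 2 < size s -> x \in s -> next s x != prev s x.
Proof.
move=> us ss xs; apply/eqP => e.
have := next_next_neq us ss xs.
by rewrite e next_prev// eqxx.
Qed.

Lemma cycle_neighbours s x : ucycle (@adj G) s -> x \in s ->
  [set next s x; prev s x] \subset [set y in s | adj x y].
Proof.
move=> /andP[cs us] xs; apply/subsetP => y; rewrite !inE => /orP[]/eqP->.
  by rewrite mem_next xs next_cycle.
by rewrite mem_prev xs adj_sym prev_cycle.
Qed.

Lemma cycle_degree s x :
  ucycle (@adj G) s -> 2 < size s -> x \in s -> 1 < degree x.
Proof.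
move=> cs ss xs; case/andP: (cs) => _ us.
have <- : #|[set next s x; prev s x]| = 2 by rewrite cards2 next_neq_prev.
apply: subset_leq_card (subset_trans (cycle_neighbours cs xs) _).
by apply/subsetP => y; rewrite !inE => /andP[].
Qed.

(** The successor and the predecessor on a cycle are distinct, so they already fill a set of at most
    two neighbours: the cycle has no chord at [x]. *)
Lemma cycle_neighboursE s x : ucycle (@adj G) s -> 2 < size s -> x \in s ->
  #|[set y in s | adj x y]| <= 2 ->
  [set y in s | adj x y] = [set next s x; prev s x].
Proof.
move=> cs ss xs le2; case/andP: (cs) => _ us; apply/esym/eqP.
by rewrite eqEcard cycle_neighbours// cards2 next_neq_prev.
Qed.

(** Criterion for both extremal graphs. A cycle running through all of [S] uses two edges at each
    vertex, and there are no more inside [S]; so its edge set is the set [E] of all edges inside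
    [S]. *)
Lemma unicyclic_vertex_set (S : {set G}) s0 :
  ucycle (@adj G) s0 -> 2 < size s0 ->
  (forall s, ucycle (@adj G) s -> 2 < size s -> s =i S) ->
  (forall x, x \in S -> #|[set y in S | adj x y]| <= 2) ->
  unicyclic G.
Proof.
move=> cs0 ss0 sS S2.
pose E := [set [set e.1; e.2] | e : G * G in
  [set e | [&& e.1 \in S, e.2 \in S & adj e.1 e.2]]].
have edgesE s : ucycle (@adj G) s -> 2 < size s -> cycle_edges s = E.
  move=> cs ss; case/andP: (cs) => cs1 us.
  apply/setP => e; apply/imsetP/imsetP => [[x xs ->]|[[x y]]].
    by exists (x, next s x); rewrite // inE /= -!(sS s) // mem_next xs next_cycle.
  rewrite inE /= => /and3P[xS yS xy] ->.
  have xs : x \in s by rewrite (sS s).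
  have : y \in [set y in s | adj x y] by rewrite inE (sS s) // yS.
  rewrite cycle_neighboursE //; last first.
    apply: leq_trans (S2 x xS); apply: subset_leq_card.
    by apply/subsetP => z; rewrite !inE (sS s).
  rewrite !inE => /orP[]/eqP->; first by exists x.
  by exists (prev s x); rewrite ?mem_prev// next_prev// setUC.
exists E; split; first by exists s0; rewrite edgesE.
by move=> _ [s [cs ss ->]]; rewrite edgesE.
Qed.

(** Take for [d v] the least length of a walk from [v] to [s]; the first step of a shortest walk
    leads strictly nearer. *)
Lemma distance_to s : s != [::] ->
  exists d : G -> nat, forall v, v \notin s ->
    exists2 w, adj v w & d w < d v.
Proof.
case: s => // c s _.
pose P v k := [exists t : k.-tuple G, path (@adj G) v t && (last v t \in c :: s)].
have exP v : exists k, P v k.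
  have /connectP[t vt e] := adj_connected v c.
  by exists (size t); apply/existsP; exists (in_tuple t); rewrite /= vt -e mem_head.
exists (fun v => ex_minn (exP v)) => v vs.
case: ex_minnP => -[|k] /existsP[t /andP[]].
  by rewrite tuple0 /= (negPf vs).
case/tupleP: t => w t /= /andP[vw wt] lt _.
exists w => //; case: ex_minnP => m _ le; rewrite ltnS; apply: le.
by apply/existsP; exists t; rewrite wt.
Qed.

End Cycles.

(** * Degrees and their sum *)

Lemma degree_lt (G : sgraph) (u : G) : degree u < #|G|.
Proof.
rewrite -cardsT; apply: proper_card; apply/properP; split.
  exact: subsetT.
by exists u; rewrite !inE// adj_irr.
Qed.

(** Both sides count darts, the ordered pairs of adjacent vertices; each edge carries two. *)
Lemma sum_degree (G : sgraph) :
  \sum_(u : G) degree u = #|[set e : G * G | adj e.1 e.2]|.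
Proof.
rewrite -sum1_card (eq_bigl (fun e : G * G => true && adj e.1 e.2)); last first.
  by move=> e; rewrite inE.
rewrite -(pair_big_dep xpredT (@adj G) (fun _ _ => 1)) /=.
apply: eq_bigr => u _; rewrite /degree -sum1_card.
by apply: eq_bigl => v; rewrite inE.
Qed.

(** * Degrees in a unicyclic graph *)

Section Unicyclic.
Variables (G : sgraph) (s : seq G).
Hypotheses (cs : ucycle (@adj G) s) (ss : 2 < size s).
Hypothesis (unis : forall t : seq G, ucycle (@adj G) t -> 2 < size t ->
  cycle_edges t = cycle_edges s).
Implicit Types (u v w x y : G).

(* Each vertex points to a neighbour: along the cycle, or towards it. *)
Lemma successor_exists : exists (p : G -> G) (d : G -> nat),
  [/\ forall v, adj v (p v), forall v, v \in s -> p v = next s v &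
      forall v, v \notin s -> d (p v) < d v].
Proof.
have [d dP] : exists d : G -> nat, forall v, v \notin s ->
    exists2 w, adj v w & d w < d v.
  by apply: distance_to; case: s ss.
(* The default [v] is never taken: off [s] a nearer neighbour exists by [dP]. *)
pose p v := if v \in s then next s v else
  odflt v [pick w | adj v w && (d w < d v)].
have pP v : v \notin s -> adj v (p v) && (d (p v) < d v).
  move=> vs; rewrite /p (negPf vs); case: pickP => [//|no].
  by have [w vw dw] := dP v vs; have := no w; rewrite vw dw.
exists p, d; split=> [v|v vs|v /pP/andP[]//].
  case: (boolP (v \in s)) => [vs|/pP/andP[]//].
  by rewrite /p vs next_cycle//; case/andP: cs.
by rewrite /p vs.
Qed.

(** The darts [(v, p v)] and [(p v, v)] are pairwise distinct, and any further dart would lie on a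
    second cycle. *)
Lemma unicyclic_sum_degree : \sum_(u : G) degree u = 2 * #|G|.
Proof.
have [p [d [adj_p p_s d_p]]] := successor_exists.
have /andP[cs1 us] := cs.
(* On the cycle, a length above 2 forbids turning back; off it, [d] decreases until the pointers
   enter [s], which they never leave. *)
have ppN v : p (p v) != v.
  apply/eqP => ppv; case: (boolP (v \in s)) => vs.
    have := next_next_neq us ss vs.
    by rewrite -(p_s v)// -p_s ?ppv ?eqxx// p_s// mem_next.
  have := d_p v vs; case: (boolP (p v \in s)) => [pvs|/d_p].
    by have := vs; rewrite -{1}ppv p_s// mem_next pvs.
  by rewrite ppv; lia.
pose dart (z : G * bool) := if z.2 then (z.1, p z.1) else (p z.1, z.1).
have dart_inj : injective dart.
  move=> [v []] [w []]; rewrite /dart /= => -[].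
  - by move=> ->.
  - by move=> -> e; have := ppN w; rewrite e eqxx.
  - by move=> e vE; have := ppN v; rewrite e -vE eqxx.
  - by move=> _ ->.
have dart_onto : [set e : G * G | adj e.1 e.2] = [set dart z | z in setT].
  apply/setP => -[x y]; rewrite inE /=; apply/idP/imsetP; last first.
    by case=> -[v []] _ [-> ->] //; rewrite adj_sym.
  move=> xy; case: (eqVneq y (p x)) => [->|ypx]; first by exists (x, true).
  case: (eqVneq x (p y)) => [->|xpy]; first by exists (y, false).
  exfalso.
  (* Without the edge [x, y], [p] still leads from both ends to the cycle [s]. *)
  pose e' := [rel u v | adj u v && ([set u; v] != [set x; y])].
  have e'_sym : symmetric e' by move=> u v; rewrite /= adj_sym setUC.
  have pset v : [set v; p v] != [set x; y].
    apply/eqP => E.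
    have : v \in [set x; y] by rewrite -E !inE eqxx.
    have : p v \in [set x; y] by rewrite -E !inE eqxx orbT.
    have pvv : p v != v by apply/eqP => pvv; have := ppN v; rewrite !pvv eqxx.
    rewrite !inE => pv /orP[]/eqP vE; subst v.
      by move: pv; rewrite (negPf pvv) eq_sym (negPf ypx).
    by move: pv; rewrite (negPf pvv) eq_sym (negPf xpy).
  have e'p v : connect e' v (p v) by apply: connect1; rewrite /= adj_p pset.
  have sub : subrel (connect (frel p)) (connect e').
    by apply: connect_sub => u _ /eqP <-.
  have to_s v : exists2 c, c \in s & connect e' v c.
    have [k] := ubnP (d v); elim: k v => // k IH v dv.
    case: (boolP (v \in s)) => [vs|/d_p dpv]; first by exists v.
    have [c cins pc] := IH (p v) ltac:(lia).
    by exists c => //; apply: connect_trans (e'p v) pc.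
  (* Since [p] runs around [s], the cycle links the two points where the pointers from [x] and [y]
     arrive. *)
  have fcs : fcycle p s.
    apply: cycle_from_next => // v vs.
    by rewrite /= p_s.
  have : connect e' x y.
    have [c cins xc] := to_s x; have [c' c'ins yc'] := to_s y.
    apply: connect_trans xc _; apply: (@connect_trans _ _ c').
      by apply: sub; rewrite (fconnect_cycle fcs cins) c'ins.
    by rewrite (sym_connect_sym e'_sym).
  (* Shortened to a simple path, this connection closes up with the edge between [y] and [x] to a
     cycle. *)
  case/connectP => q0 xq0; case: (shortenP xq0) => q xq uq _ yE {q0 xq0}.
  have xN : x != y by apply: contraTneq xy => ->; rewrite adj_irr.
  have cq : ucycle (@adj G) (x :: q).
    rewrite /ucycle uq andbT /= rcons_path -yE adj_sym xy andbT.
    by apply: sub_path xq => u v /andP[].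
  (* A path of a single step would be the removed edge itself. *)
  have sq : 2 < size (x :: q).
    case: q xq {uq cq} yE => [|y' [|? ?]] //= xq yE.
      by rewrite yE eqxx in xN.
    by move: xq; rewrite yE eqxx andbF.
  have : [set y; x] \in cycle_edges (x :: q).
    apply/imsetP; exists y; first by rewrite yE mem_last.
    congr [set _; _]; rewrite yE.
    by have := cycle_next uq; rewrite /= rcons_path => /andP[_ /eqP].
  (* By uniqueness the new cycle has the edges of [s], which all have the form [[set v; p v]],
     against [pset]. *)
  rewrite unis// => /imsetP[v vs]; rewrite -p_s// => E.
  by have := pset v; rewrite -E setUC eqxx.
by rewrite sum_degree dart_onto card_imset// cardsT card_prod card_bool mulnC.
Qed.

Lemma unicyclic_degree_gt0 u : 0 < degree u.
Proof.
have [p [_ [adj_p _ _]]] := successor_exists.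
by apply/card_gt0P; exists (p u); rewrite inE.
Qed.

Lemma unicyclic_degree_gt1 :
  exists2 A : {set G}, #|A| = 3 & forall u, u \in A -> 1 < degree u.
Proof.
have /andP[_ us] := cs.
exists [set u in take 3 s]; last first.
  by move=> u; rewrite inE => /mem_take; apply: cycle_degree.
by rewrite cardsE (card_uniqP _) ?take_uniq// size_takel//.
Qed.

End Unicyclic.


Lemma unicyclicE (G : sgraph) : unicyclic G ->
  exists s : seq G, [/\ ucycle (@adj G) s, 2 < size s &
    forall t : seq G, ucycle (@adj G) t -> 2 < size t ->
      cycle_edges t = cycle_edges s].
Proof.
move=> [C [[s [cs ss ->]] uC]]; exists s; split=> // t ct st.
by apply/esym/uC; exists t.
Qed.

(** * The cycle graph, extremal for the upper bound *)

Section CycleGraph.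
Variable m : nat.
Let n := m.+3.

Definition cycle_rel (i j : 'I_n) := (j == ordS i) || (i == ordS j).

Lemma val_iter_ordS k (i : 'I_n) : iter k (@ordS n) i = (i + k) %% n :> nat.
Proof.
elim: k => [|k IH]; first by rewrite addn0 modn_small.
by rewrite iterS /= IH -addn1 modnDml addn1 addnS.
Qed.

Lemma fconnect_ordS (i j : 'I_n) : fconnect (@ordS n) i j.
Proof.
(* From [i], [n - i] steps lead around to 0, and [j] more lead to [j]. *)
suff -> : j = iter (n - i + j) (@ordS n) i by apply: fconnect_iter.
apply: val_inj; rewrite [RHS]val_iter_ordS addnA subnKC; last exact: ltnW.
by rewrite modnDl modn_small.
Qed.

Lemma iter_ordS_neq k (i : 'I_n) : 0 < k -> k < n -> iter k (@ordS n) i != i.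
Proof.
move=> k0 kn; rewrite -val_eqE /= val_iter_ordS -[X in _ != X](modn_small (ltn_ord i)).
by rewrite -[X in _ != X %% _]addn0 eqn_modDl !modn_small// -lt0n.
Qed.

Lemma ordS_neq_pred (i : 'I_n) : ordS i != ord_pred i.
Proof.
by rewrite -(inj_eq (@ordS_inj n)) ord_predK; apply: (iter_ordS_neq (k := 2)).
Qed.

Lemma cycle_rel_sym : symmetric cycle_rel.
Proof. by move=> i j; rewrite /cycle_rel orbC. Qed.

Lemma cycle_rel_irr : irreflexive cycle_rel.
Proof.
move=> i; rewrite /cycle_rel orbb eq_sym.
exact: negPf (@iter_ordS_neq 1 i isT isT).
Qed.

Lemma cycle_rel_connected (i j : 'I_n) : connect cycle_rel i j.
Proof.
apply: connect_sub (fconnect_ordS i j) => u _ /eqP <-.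
by apply: connect1; rewrite /cycle_rel eqxx.
Qed.

Lemma cycle_rel_has_edge : exists i j, cycle_rel i j.
Proof. by exists ord0, (ordS ord0); rewrite /cycle_rel eqxx. Qed.

Definition cycle_graph := SGraph cycle_rel_sym cycle_rel_irr
  cycle_rel_connected cycle_rel_has_edge.

Lemma cycle_graph_neighbours (i : cycle_graph) :
  [set j | adj i j] = [set (ordS i : cycle_graph); (ord_pred i : cycle_graph)].
Proof.
apply/setP => j; rewrite !inE /= /cycle_rel.
by rewrite (eq_sym i) (can2_eq (@ordSK n) (@ord_predK n)).
Qed.

Lemma cycle_graph_degree (i : cycle_graph) : degree i = 2.
Proof. by rewrite /degree cycle_graph_neighbours cards2 ordS_neq_pred. Qed.

(** A cycle through a vertex uses both of its only two neighbours, so it is closed under [ordS] and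
    visits every vertex. *)
Lemma cycle_graph_unicyclic : unicyclic cycle_graph.
Proof.
have orbit_in j : j \in orbit (@ordS n) ord0.
  by rewrite -fconnect_orbit fconnect_ordS.
apply: (@unicyclic_vertex_set cycle_graph setT (orbit (@ordS n) ord0)).
- rewrite /ucycle orbit_uniq andbT.
  apply: sub_cycle (cycle_orbit (@ordS_inj n) ord0) => i j /eqP <-.
  by rewrite /= /cycle_rel eqxx.
- rewrite -(card_uniqP (orbit_uniq _ _)).
  by rewrite (eq_card (B := 'I_n)) ?card_ord// => j; rewrite orbit_in.
- move=> s cs ss j; have /andP[_ us] := cs.
  have closed_s (i : cycle_graph) : i \in s -> (ordS i : cycle_graph) \in s.
    move=> ins; have : (ordS i : cycle_graph) \in [set j | adj i j].
      by rewrite cycle_graph_neighbours !inE eqxx.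
    rewrite (_ : [set j | adj i j] = [set next s i; prev s i]).
      by rewrite !inE => /orP[]/eqP->; rewrite ?mem_next ?mem_prev.
    apply/esym/eqP; rewrite eqEcard cards2 next_neq_prev//.
    rewrite [X in X <= _]cycle_graph_degree andbT.
    apply: subset_trans (cycle_neighbours cs ins) _.
    by apply/subsetP => k; rewrite !inE => /andP[].
  rewrite inE; have [i ins] : exists i, i \in s.
    by case: s ss {cs us closed_s} => // i s _; exists i; rewrite mem_head.
  have /iter_findex <- := fconnect_ordS i j.
  by elim: (findex _ _ _) => //= k; apply: closed_s.
- by move=> i _; rewrite -(cycle_graph_degree i) subset_leq_card//;
    apply/subsetP => j; rewrite !inE.
Qed.

End CycleGraph.

(** * The extremal graph for the lower bound *)

Section PendantTriangle.
Variable m : nat.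
Let n := m.+3.

(* The triangle on 0, 1, 2, with all the other vertices pendant at 0. *)
Definition pendant_rel (i j : 'I_n) :=
  (i != j) && [|| i == ord0, j == ord0 | (i < 3) && (j < 3)].

Lemma pendant_rel_sym : symmetric pendant_rel.
Proof. by move=> i j; rewrite /pendant_rel eq_sym orbCA (andbC (i < 3)). Qed.

Lemma pendant_rel_irr : irreflexive pendant_rel.
Proof. by move=> i; rewrite /pendant_rel eqxx. Qed.

Lemma pendant_rel_connected (i j : 'I_n) : connect pendant_rel i j.
Proof.
have to0 (k : 'I_n) : connect pendant_rel k ord0.
  have [->|k0] := eqVneq k ord0; first exact: connect0.
  by apply: connect1; rewrite /pendant_rel k0 eqxx orbT.
apply: connect_trans (to0 i) _.
by rewrite (sym_connect_sym pendant_rel_sym).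
Qed.

Lemma pendant_rel_has_edge : exists i j, pendant_rel i j.
Proof. by exists ord0, ord_max. Qed.

Definition pendant_triangle := SGraph pendant_rel_sym pendant_rel_irr
  pendant_rel_connected pendant_rel_has_edge.

Lemma pendant_triangle_degree (i : pendant_triangle) :
  degree i = if i < 1 then n - 1 else if i < 3 then 2 else 1.
Proof.
case: i => -[|[|[|k]]] kn /=; set i := Ordinal kn.
- rewrite /degree (_ : [set v | _] = [set~ (i : pendant_triangle)]).
    by rewrite cardsC1 card_ord subn1.
  by apply/setP => j; rewrite !inE /= /pendant_rel andbT eq_sym.
- rewrite /degree (_ : [set v | _] =
    [set (inord 0 : pendant_triangle); (inord 2 : pendant_triangle)]).
    by rewrite cards2 -val_eqE /= !inordK.
  apply/setP => j; rewrite !inE /= /pendant_rel -!val_eqE /= !inordK//; lia.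
- rewrite /degree (_ : [set v | _] =
    [set (inord 0 : pendant_triangle); (inord 1 : pendant_triangle)]).
    by rewrite cards2 -val_eqE /= !inordK.
  apply/setP => j; rewrite !inE /= /pendant_rel -!val_eqE /= !inordK//; lia.
- rewrite /degree (_ : [set v | _] = [set (inord 0 : pendant_triangle)]).
    by rewrite cards1.
  apply/setP => j; rewrite !inE /= /pendant_rel -!val_eqE /= !inordK//; lia.
Qed.

(** Vertices on a cycle have degree at least 2, hence are among 0, 1, 2; having at least three
    vertices, the cycle takes all of these. *)
Lemma pendant_triangle_unicyclic : unicyclic pendant_triangle.
Proof.
pose S := [set i : pendant_triangle | i < 3].
have S3 : #|S| = 3.
  rewrite (_ : S = [set widen_ord (isT : 3 <= n) k | k in setT]).
    rewrite card_imset ?cardsT ?card_ord// => k l /(congr1 val) /= kl.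
    exact: val_inj.
  apply/setP => i; rewrite inE.
  apply/idP/imsetP => [i3|[k _ ->]]; last by case: k.
  by exists (Ordinal i3) => //; apply: val_inj.
apply: (@unicyclic_vertex_set pendant_triangle S
  [:: (inord 0 : pendant_triangle); inord 1; inord 2]) => //.
- rewrite /ucycle /= /pendant_rel !inE -!val_eqE /= !inordK//.
- move=> s cs ss; have /andP[_ us] := cs.
  have sub : {subset s <= S}.
    move=> i ins; have := cycle_degree cs ss ins.
    rewrite pendant_triangle_degree inE.
    by case: (ltnP i 1) => [i1 _|_]; [apply: ltn_trans i1 _ | case: ifP].
  apply/(subset_cardP _ (introT subsetP sub)).
  apply/eqP; rewrite eqn_leq subset_leq_card /=; last exact/subsetP.
  by rewrite S3 (card_uniqP us).
- move=> x xS; apply: leq_trans (subset_leq_card (_ : _ \subset S :\ x)) _.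
    by apply/subsetP => y; rewrite !inE => /andP[-> /andP[xy _]]; rewrite eq_sym xy.
  by have := cardsD1 x S; rewrite S3 xS; lia.
Qed.

End PendantTriangle.

(** * Concavity bounds for sums over degrees *)

Local Open Scope classical_set_scope.
Local Open Scope ring_scope.

(** Stated without denominators, so that it covers [a = c] and can be fed directly to [lra]. *)
Lemma concave_chord (R : realType) (g : R -> R) (a b c : R) :
  concave_function `[1, +oo[%classic g -> 1 <= a -> a <= b -> b <= c ->
  (c - b) * g a + (b - a) * g c <= (c - a) * g b.
Proof.
move=> gc a1 ab bc.
have [ac|] := ltP a c; last first.
  move=> ca; have -> : c = b by lra.
  have -> : a = b by lra.
  by lra.
have ca0 : 0 < c - a by lra.
(* This is the weight of [a] when [b] is written as a convex combination of [a] and [c]. *)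
have t0 : 0 <= (c - b) / (c - a) by rewrite divr_ge0//; lra.
have t1 : (c - b) / (c - a) <= 1 by rewrite ler_pdivrMr//; lra.
have := gc (Itv01 t0 t1) a c.
rewrite !classical_sets.inE /= !in_itv /= !andbT => /(_ a1 ltac:(lra)).
have convE (u v : convex_lmodType R^o) :
    conv (Itv01 t0 t1) u v =
    (c - b) / (c - a) * (u : R) + (1 - (c - b) / (c - a)) * (v : R) by [].
have -> : conv (Itv01 t0 t1) (a : convex_lmodType R^o) c = b.
  by rewrite convE; field; lra.
rewrite convRE /= /unstable.onem -(ler_pM2l ca0) => le.
have E : (c - a) * ((c - b) / (c - a) * - g a +
  (1 - (c - b) / (c - a)) * - g c) = - ((c - b) * g a + (b - a) * g c).
  by field; lra.
by move: le; rewrite E mulrN lerN2.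
Qed.

Section DegreeSum.
Variables (R : realType) (g : R -> R).
Hypothesis gc : concave_function `[1, +oo[%classic g.
Variables (T : finType) (d : T -> nat).
Hypothesis d_gt0 : forall u, (0 < d u)%N.
Hypothesis sum_d : (\sum_u d u = 2 * #|T|)%N.

(** The line through [(2, g 2)] and [(3, g 3)] lies on or above [g] at all positive integers, and
    the deviations [d u - 2] sum to 0. *)
Lemma sum_concave_le : \sum_u g (d u)%:R <= #|T|%:R * g 2.
Proof.
have le u : g (d u)%:R <= g 2 + (g 3 - g 2) * ((d u)%:R - 2).
  have := d_gt0 u; case: (d u) => [//|[|[|k]]] _.
  - by have := @concave_chord R g 1 2 3 gc; lra.
  - by lra.
  - have k3 : (3 : R) <= k.+3%:R by rewrite ler_nat.
    by have := @concave_chord R g 2 3 k.+3%:R gc; lra.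
apply: le_trans (ler_sum _ (fun u _ => le u)) _.
rewrite big_split /= sumr_const -mulr_sumr sumrB -natr_sum sum_d sumr_const.
by rewrite natrM -[g 2 *+ _]mulr_natl -[2 *+ _]mulr_natl; lra.
Qed.

(* The chord of [g] over [2, n - 1] has slope [s <= g 2 - g 1], so the chord
   moved down to start at [(1, g 1)] is also below [g]; the slack
   [g 2 - g 1 - s] is only kept on the three elements of [A]. *)
Lemma sum_concave_ge (A : {set T}) :
  (3 < #|T|)%N -> (forall u, (d u < #|T|)%N) -> #|A| = 3 ->
  (forall u, u \in A -> (1 < d u)%N) ->
  g (#|T| - 1)%:R + 2 * g 2 + (#|T| - 3)%:R * g 1 <= \sum_u g (d u)%:R.
Proof.
move=> T4 d_lt A3 Ad.
have n4 : (4 : R) <= #|T|%:R by rewrite ler_nat.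
rewrite !natrB 1?(leq_trans _ T4)//.
set n : R := #|T|%:R in n4 *.
pose s := (g (n - 1) - g 2) / (n - 3).
have sE : s * (n - 3) = g (n - 1) - g 2 by rewrite divfK// gt_eqF//; lra.
have s_le : s <= g 2 - g 1.
  rewrite -(ler_pM2r (_ : 0 < n - 3)) ?sE; last by lra.
  by have := @concave_chord R g 1 2 (n - 1) gc; lra.
have ge2 u : (1 < d u)%N -> g 2 + s * ((d u)%:R - 2) <= g (d u)%:R.
  move=> du; have du2 : (2 : R) <= (d u)%:R by rewrite ler_nat.
  have dun : (d u)%:R <= n - 1.
    by rewrite lerBrDr -(natrD _ _ 1) ler_nat addn1 d_lt.
  rewrite -(ler_pM2l (_ : 0 < n - 3)); last by lra.
  have := @concave_chord R g 2 (d u)%:R (n - 1) gc ltac:(lra) du2 dun.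
  by rewrite mulrDr mulrA (mulrC _ s) sE; lra.
have ge1 u : g 1 + (g 2 - g 1 - s) * (u \in A)%:R + s * ((d u)%:R - 1)
    <= g (d u)%:R.
  case: (boolP (u \in A)) => [/Ad/ge2|_] /=; first by lra.
  have := d_gt0 u; rewrite leq_eqVlt => /predU1P[<-|/ge2]; lra.
(* The terms [d u - 1] sum to [n] and the slack counts three times, leaving [s * (n - 3)], which is
   [g (n - 1) - g 2], besides [3 * g 2 + (n - 3) * g 1]. *)
apply: le_trans (ler_sum _ (fun u _ => ge1 u)).
rewrite !big_split /= !sumr_const -!mulr_sumr sumrB -!natr_sum sum_d sumr_const.
rewrite (_ : (\sum_u _ = 3)%N); last by rewrite -big_mkcond sum1_card.
by rewrite natrM -[g 1 *+ _]mulr_natl -/n; lra.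
Qed.

End DegreeSum.

(** * Passage to logarithms and the sharp bounds *)

Lemma II_expR (R : realType) (f : R -> R) (G : sgraph) :
  (forall x : R, 1 <= x -> 0 < f x) -> (forall u : G, (0 < degree u)%N) ->
  II f G = expR (\sum_(u : G) ln (f (degree u)%:R)).
Proof.
move=> f_gt0 deg_gt0; rewrite expR_sum; apply: eq_bigr => u _.
by rewrite lnK// posrE f_gt0// ler1n.
Qed.

(* [f] is only constrained, and only evaluated, on [1, +oo[. *)
Theorem theorem3p7 (R : realType) (n : nat) (f : R -> R) :
  (4 <= n)%N ->
  (forall x : R, 1 <= x -> 0 < f x) ->
  concave_function `[1, +oo[ (fun x : R => ln (f x)) ->
  [/\ forall G : sgraph, unicyclic G -> #|G| = n ->
        f (n - 1)%:R * f 2 ^+ 2 * f 1 ^+ (n - 3) <= II f G /\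
        II f G <= f 2 ^+ n,
      exists G : sgraph, [/\ unicyclic G, #|G| = n &
        II f G = f (n - 1)%:R * f 2 ^+ 2 * f 1 ^+ (n - 3)]
    & exists G : sgraph, [/\ unicyclic G, #|G| = n & II f G = f 2 ^+ n]].
Proof.
move=> n4 f_gt0 gc; have n3 : (2 < n)%N by apply: ltnW.
have fE x : 1 <= x -> f x = expR (ln (f x)).
  by move=> x1; rewrite lnK// posrE f_gt0.
have expRX x k : 1 <= x -> f x ^+ k = expR (k%:R * ln (f x)).
  by move=> x1; rewrite {1}fE// -expRM_natl.
split.
- move=> G /unicyclicE[s [cs ss unis]] Gn.
  have d_gt0 := unicyclic_degree_gt0 cs ss.
  have sum_d := unicyclic_sum_degree cs ss unis.
  rewrite (II_expR f_gt0 d_gt0); split.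
    have [A A3 Ad] := unicyclic_degree_gt1 cs ss.
    rewrite (fE (n - 1)%:R) ?ler1n ?subn_gt0 1?ltnW// !expRX ?ler1n// -!expRD.
    rewrite ler_expR -Gn.
    apply: (sum_concave_ge gc d_gt0 sum_d _ _ A3 Ad); rewrite ?Gn//.
    by move=> u; rewrite -Gn; apply: degree_lt.
  rewrite expRX ?ler1n// ler_expR -Gn.
  exact: (sum_concave_le gc d_gt0 sum_d).
- case: n n4 n3 => [|[|[|m]]] // n4 _; exists (pendant_triangle m).
  split; [exact: pendant_triangle_unicyclic | by rewrite card_ord|].
  rewrite /II; under eq_bigr do rewrite pendant_triangle_degree.
  (* Splitting off the three corners, of degrees [n - 1], 2 and 2, leaves [m] pendant vertices. *)
  by rewrite !big_ord_recl /= prodr_const card_ord !subSS !subn0 expr2 !mulrA.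
- case: n n4 n3 => [|[|[|m]]] // _ _; exists (cycle_graph m).
  split; [exact: cycle_graph_unicyclic | by rewrite card_ord|].
  rewrite /II; under eq_bigr do rewrite cycle_graph_degree.
  by rewrite prodr_const card_ord.
Qed.
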